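(* Let $C = C_1 \cup C_2 \subset \mathbb{P}^{2r+1}$ be a disjoint union of two complete intersections $C_1, C_2$ of dimension $r$. Then $I_C^m = I_C^{(m)}$ for all positive integers $m$.
   Context: $R = k[x_0,\ldots,x_{2r+1}]$ with $k$ an algebraically closed field of characteristic zero. $I_Z$ denotes the saturated homogeneous ideal of a subscheme $Z$; a complete intersection $C_i$ is a subscheme whose saturated ideal is generated by a regular sequence. For a nonzero homogeneous ideal $I$, $I^{(m)} = \bigcap_{\mathfrak{p} \in \mathrm{Ass}(I)} (I^m R_{\mathfrak{p}} \cap R)$. *)

(* Defs.v *)
From HB Require Import structures.
From mathcomp Require Import all_boot all_order all_algebra.
From mathcomp Require Import mpoly.

Set Implicit Arguments.
Unset Strict Implicit.
Unset Printing Implicit Defensive.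

Import GRing.Theory.
Local Open Scope ring_scope.

Section Ideals.
Context {n : nat} {k : nzRingType}.
Local Notation P := {mpoly k[n]}.

Definition pset := P -> Prop.

Definition set_eq (I J : pset) : Prop := forall f, I f <-> J f.

Definition gen_ideal (s : seq P) : pset :=
  fun f => exists c : 'I_(size s) -> P, f = \sum_(i < size s) c i * s`_i.

Definition ideal_sum (I J : pset) : pset :=
  fun f => exists a b, I a /\ J b /\ f = a + b.

Definition ideal_cap (I J : pset) : pset := fun f => I f /\ J f.

Definition ideal_mul (I J : pset) : pset :=
  fun f => exists (N : nat) (a b : 'I_N -> P),
    (forall i, I (a i) /\ J (b i)) /\ f = \sum_(i < N) a i * b i.

Fixpoint ideal_pow (I : pset) (m : nat) : pset :=
  match m with
  | 0 => fun _ => True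
  | m'.+1 => ideal_mul (ideal_pow I m') I
  end.

Definition is_ideal (I : pset) : Prop :=
  I 0 /\ (forall a b, I a -> I b -> I (a + b)) /\ (forall a b, I b -> I (a * b)).

Definition prime_ideal (p : pset) : Prop :=
  is_ideal p /\ ~ p 1 /\ (forall a b, p (a * b) -> p a \/ p b).

Definition assoc_prime (I : pset) (p : pset) : Prop :=
  prime_ideal p /\ exists f : P, forall g, p g <-> I (g * f).

(* Symbolic power: I^(m) = intersection over p in Ass(I) of (I^m R_p) ∩ R;
   g lies in I^m R_p ∩ R iff s g ∈ I^m for some s ∉ p. *)
Definition symbolic_pow (I : pset) (m : nat) : pset :=
  fun g => forall p, assoc_prime I p -> exists s, ~ p s /\ ideal_pow I m (s * g).

Definition homog_of_deg (d : nat) (f : P) : bool :=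
  all [pred mm | mdeg mm == d] (msupp f).

Definition regular_seq (s : seq P) : Prop :=
  (forall i, (i < size s)%N ->
     forall g, gen_ideal (take i s) (g * s`_i) -> gen_ideal (take i s) g)
  /\ ~ gen_ideal s 1.

(* I is the saturated ideal of an r-dimensional complete intersection in
   P^(n-1): it is generated by a homogeneous regular sequence of length
   n-1-r (the codimension). *)
Definition complete_intersection_ideal (r : nat) (I : pset) : Prop :=
  exists s : seq P,
    size s = (n - 1 - r)%N /\
    (forall f, f \in s -> exists d, homog_of_deg d f) /\
    regular_seq s /\ set_eq I (gen_ideal s).

(* The subschemes with saturated ideals I and J are disjoint: the saturation
   of I + J is R, i.e. I + J contains a power of the irrelevant ideal. *)
Definition disjoint_schemes (I J : pset) : Prop :=
  exists N : nat, forall i : 'I_n, ideal_sum I J ('X_i ^+ N).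

End Ideals.

(* Main.v *)
Require Import Defs.
From HB Require Import structures.
From mathcomp Require Import all_boot all_order all_algebra.
From mathcomp Require Import mpoly ring.
From Stdlib Require Import Classical ClassicalEpsilon.
From Stdlib Require Import FunctionalExtensionality PropExtensionality.

(* Write I1 = (f), I2 = (g), with c = r + 1 generators each in n = 2c variables.
   As (f, g) contains powers of the variables, which form a regular sequence of
   length n, the Koszul homology of (f, g) on R vanishes in positive degree;
   since f is regular, this gives H_i(g; R/I1) = 0 for i > 0. In degree 1 it
   says that I1 and I2 meet in I1 I2; in degree c it says that I1 : I2 = I1, so
   every associated prime of I1 is one of I1 \cap I2. A regular sequence is
   quasi-regular (Rees): the coefficients of a form of degree m in f lying in
   I1^(m+1) lie in I1. Hence I1^m has no associated primes besides those of I1,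
   so the symbolic power is contained in the intersection of I1^m and I2^m, and
   quasi-regularity also lifts I1 \cap I2 = I1 I2 to I1^m \cap I2^m = I1^m I2^m. *)

Set Implicit Arguments.
Unset Strict Implicit.
Unset Printing Implicit Defensive.

Import Order.TTheory GRing.Theory.
Local Open Scope ring_scope.

(** * Ideals: generators, products and powers *)

Section IdealTheory.
Context {n : nat} {k : comNzRingType}.
Local Notation P := {mpoly k[n]}.
Implicit Types (I J C : @pset n k) (s : seq P) (x y z f : P).

Lemma ideal0 I : is_ideal I -> I 0. Proof. by case. Qed.

Lemma idealD I x y : is_ideal I -> I x -> I y -> I (x + y).
Proof. by case=> _ [+ _]; apply. Qed.

Lemma idealMl I x y : is_ideal I -> I y -> I (x * y).
Proof. by case=> _ [_ +]; apply. Qed.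

Lemma idealMr I x y : is_ideal I -> I x -> I (x * y).
Proof. by rewrite mulrC; apply: idealMl. Qed.

Lemma idealN I x : is_ideal I -> I x -> I (- x).
Proof. by rewrite -mulN1r; apply: idealMl. Qed.

Lemma idealB I x y : is_ideal I -> I x -> I y -> I (x - y).
Proof. by move=> hI Ix Iy; apply: idealD => //; apply: idealN. Qed.

Lemma gen_nil x : gen_ideal [::] x <-> x = 0.
Proof.
split=> [[c ->]|->]; first by rewrite big_ord0.
by exists (fun=> 0); rewrite big_ord0.
Qed.

Lemma gen_cons f s x :
  gen_ideal (f :: s) x <-> exists a y, gen_ideal s y /\ x = a * f + y.
Proof.
split=> [[c ->]|[a [y [[c ->] ->]]]].
  rewrite big_ord_recl /=; exists (c ord0).
  by exists (\sum_(i < size s) c (lift ord0 i) * s`_i); split; first by eexists.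
exists (fun i => oapp c a (unlift ord0 i)).
rewrite big_ord_recl /= unlift_none /=; congr (_ + _).
by apply: eq_bigr => i _; rewrite liftK.
Qed.

Lemma gen_is_ideal s : is_ideal (gen_ideal s).
Proof.
elim: s => [|f s [h0 [hD hM]]].
  split; first exact/gen_nil.
  split=> [a b /gen_nil-> /gen_nil->|a b /gen_nil->]; apply/gen_nil.
    by rewrite addr0.
  by rewrite mulr0.
split; first by apply/gen_cons; exists 0, 0; rewrite mul0r addr0.
split=> [x y /gen_cons[a [u [su ->]]] /gen_cons[b [v [sv ->]]]|a x].
  by apply/gen_cons; exists (a + b), (u + v); split; [exact: hD | ring].
move=> /gen_cons[b [u [su ->]]].
by apply/gen_cons; exists (a * b), (a * u); split; [exact: hM | ring].
Qed.

Lemma gen_mem s x : x \in s -> gen_ideal s x.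
Proof.
elim: s => // f s IHs; rewrite inE => /orP[/eqP->|/IHs sx]; apply/gen_cons.
  by exists 1, 0; rewrite mul1r addr0; split=> //; apply: ideal0 (gen_is_ideal s).
by exists 0, x; rewrite mul0r add0r.
Qed.

Lemma gen_min s J : is_ideal J -> {in s, forall x, J x} ->
  forall x, gen_ideal s x -> J x.
Proof.
move=> hJ; elim: s => [|f s IHs] sJ x; first by move/gen_nil->; apply: ideal0.
move=> /gen_cons[a [y [sy ->]]]; apply: idealD => //.
  by apply: idealMl => //; apply: sJ; rewrite mem_head.
by apply: IHs sy => y' sy'; apply: sJ; rewrite in_cons sy' orbT.
Qed.

Lemma gen_sub s1 s2 : {subset s1 <= s2} ->
  forall x, gen_ideal s1 x -> gen_ideal s2 x.
Proof. by move=> s12; apply: gen_min (gen_is_ideal _) _ => x /s12/gen_mem. Qed.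

Lemma mul_ind I J (T : P -> Prop) : T 0 ->
  (forall x y, T x -> T y -> T (x + y)) ->
  (forall a b, I a -> J b -> T (a * b)) -> forall x, ideal_mul I J x -> T x.
Proof.
move=> T0 TD TM x [N [a [b [ab ->]]]]; elim/big_ind: _ => // i _.
by case: (ab i) => Ia Jb; apply: TM.
Qed.

Lemma ideal_mul0 I J : ideal_mul I J 0.
Proof. by exists 0%N, (fun=> 0), (fun=> 0); split=> [[]//|]; rewrite big_ord0. Qed.

Lemma ideal_mulM I J x y : I x -> J y -> ideal_mul I J (x * y).
Proof. by exists 1%N, (fun=> x), (fun=> y); rewrite big_ord1. Qed.

Lemma ideal_mulD I J x y :
  ideal_mul I J x -> ideal_mul I J y -> ideal_mul I J (x + y).
Proof.
move=> [N [a [b [ab ->]]]] [M [c [d [cd ->]]]].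
exists (N + M)%N, (fun i => match split i with inl j => a j | inr j => c j end).
exists (fun i => match split i with inl j => b j | inr j => d j end).
split=> [i|]; first by case: (split i).
rewrite big_split_ord /=; congr (_ + _); apply: eq_bigr => i _.
  by rewrite -[lshift _ _]/(unsplit (inl i)) unsplitK.
by rewrite -[rshift _ _]/(unsplit (inr i)) unsplitK.
Qed.

Lemma mul_is_ideal I J : is_ideal I -> is_ideal (ideal_mul I J).
Proof.
move=> hI; split; first exact: ideal_mul0.
split=> [x y|c]; first exact: ideal_mulD.
apply: mul_ind => [|x y hx hy|a b Ia Jb]; first by rewrite mulr0; apply: ideal_mul0.
  by rewrite mulrDr; apply: ideal_mulD.
by rewrite mulrA; apply: ideal_mulM => //; apply: idealMl.
Qed.

Lemma ideal_mulC I J x : ideal_mul I J x -> ideal_mul J I x.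
Proof.
move: x; apply: mul_ind; first exact: ideal_mul0.
  by move=> x y; apply: ideal_mulD.
by move=> a b Ia Jb; rewrite mulrC; apply: ideal_mulM.
Qed.

Lemma ideal_mulS I I' J J' : (forall x, I x -> I' x) -> (forall x, J x -> J' x) ->
  forall x, ideal_mul I J x -> ideal_mul I' J' x.
Proof.
move=> hI hJ; apply: mul_ind; first exact: ideal_mul0.
  by move=> x y; apply: ideal_mulD.
by move=> a b /hI Ia /hJ Jb; apply: ideal_mulM.
Qed.

Lemma pow_is_ideal I m : is_ideal (ideal_pow I m).
Proof. by elim: m => [//|m IHm]; apply: mul_is_ideal. Qed.

Lemma pow_sub I J m : (forall x, I x -> J x) ->
  forall x, ideal_pow I m x -> ideal_pow J m x.
Proof. by move=> IJ; elim: m => //= m IHm; apply: ideal_mulS. Qed.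

Lemma pow_decr I m x : ideal_pow I m.+1 x -> ideal_pow I m x.
Proof.
move: x; apply: mul_ind; first exact: ideal0 (pow_is_ideal _ _).
  by move=> x y; apply: idealD (pow_is_ideal _ _).
by move=> a b Ia _; apply: idealMr Ia; apply: pow_is_ideal.
Qed.

Lemma pow_leq I m p x : (m <= p)%N -> ideal_pow I p x -> ideal_pow I m x.
Proof.
move=> /subnKC<-; elim: (p - m)%N => [|d IHd]; first by rewrite addn0.
by rewrite addnS => /pow_decr.
Qed.

Lemma pow1 I x : is_ideal I -> ideal_pow I 1 x <-> I x.
Proof.
move=> hI; split=> [|Ix]; last by rewrite -[x]mul1r; apply: ideal_mulM.
move: x; apply: mul_ind; first exact: ideal0.
  by move=> x y; apply: idealD.
by move=> a b _; apply: idealMl.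
Qed.

Lemma powM I m p x y :
  ideal_pow I m x -> ideal_pow I p y -> ideal_pow I (m + p) (x * y).
Proof.
move=> Ix; elim: p y => [|p IHp] y.
  by move=> _; rewrite addn0; apply: idealMr => //; apply: pow_is_ideal.
rewrite addnS; move: y; apply: mul_ind; first by rewrite mulr0; apply: ideal_mul0.
  by move=> u v hu hv; rewrite mulrDr; apply: ideal_mulD.
by move=> a b Ia Ib; rewrite mulrA; apply: ideal_mulM => //; apply: IHp.
Qed.

Lemma powX I m x : I x -> ideal_pow I m (x ^+ m).
Proof. by move=> Ix; elim: m => // m IHm; rewrite exprSr; apply: ideal_mulM. Qed.

(** An [m]-fold product from [I] times one from [J] regroups into [m] products of one factor from
    each, and these lie in both ideals. *)
Lemma mul_pow_cap I J m x :
  is_ideal I -> is_ideal J ->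
  ideal_mul (ideal_pow I m) (ideal_pow J m) x -> ideal_pow (ideal_cap I J) m x.
Proof.
move=> hI hJ; move: x.
have hC p := pow_is_ideal (ideal_cap I J) p.
apply: mul_ind; [exact: ideal0 | by move=> x y; apply: idealD |].
elim: m => // m IHm x y Ix Jy; move: x Ix; apply: mul_ind.
- by rewrite mul0r; apply: ideal0.
- by move=> u v hu hv; rewrite mulrDl; apply: idealD.
move=> a b Ia Ib; move: y Jy; apply: mul_ind.
- by rewrite mulr0; apply: ideal0.
- by move=> u v hu hv; rewrite mulrDr; apply: idealD.
move=> c d Jc Jd; rewrite mulrACA; apply: ideal_mulM; first exact: IHm.
by split; [apply: idealMr | apply: idealMl].
Qed.

(** * Forms in the generators of an ideal *)

(* [form_eval s m c] is the sum of [c l * s^l] over the exponent lists [l] of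
   total degree [m]. *)
Fixpoint form_eval s (m : nat) (c : seq nat -> P) : P :=
  match s with
  | [::] => if m == 0%N then c [::] else 0
  | f :: s' =>
      \sum_(j < m.+1) f ^+ j * form_eval s' (m - j) (fun l => c ((j : nat) :: l))
  end.

Definition is_exponent s (m : nat) (l : seq nat) :=
  (size l == size s) && (sumn l == m).

Definition shift_coef (c : seq nat -> P) : seq nat -> P :=
  fun l => c ((head 0%N l).+1 :: behead l).

Lemma form_eval0 s c : form_eval s 0 c = c (nseq (size s) 0%N).
Proof.
by elim: s c => //= f s IHs c; rewrite big_ord1 expr0 mul1r subn0 IHs.
Qed.

Lemma form_evalS f s m c :
  form_eval (f :: s) m.+1 c =
  form_eval s m.+1 (fun l => c (0%N :: l)) + f * form_eval (f :: s) m (shift_coef c).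
Proof.
rewrite [LHS]/= big_ord_recl expr0 mul1r subn0 /=; congr (_ + _).
rewrite mulr_sumr; apply: eq_bigr => j _.
by rewrite /bump /= add1n exprS mulrA subSS.
Qed.

Lemma eq_form_eval s m c d :
  (forall l, is_exponent s m l -> c l = d l) -> form_eval s m c = form_eval s m d.
Proof.
elim: s m c d => [|f s IHs] m c d cd /=.
  by case: eqP => // m0; apply: cd; rewrite /is_exponent m0.
apply: eq_bigr => j _; congr (_ * _); apply: IHs => l /andP[/eqP sl /eqP ml].
by apply: cd; rewrite /is_exponent /= sl ml subnKC ?eqxx // -ltnS.
Qed.

Lemma form_evalD s m c d :
  form_eval s m (fun l => c l + d l) = form_eval s m c + form_eval s m d.
Proof.
elim: s m c d => [|f s IHs] m c d /=; first by case: eqP; rewrite ?addr0.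
by rewrite -big_split /=; apply: eq_bigr => j _; rewrite -mulrDr -IHs.
Qed.

Lemma form_evalZ s m a c :
  form_eval s m (fun l => a * c l) = a * form_eval s m c.
Proof.
elim: s m c => [|f s IHs] m c /=; first by case: eqP; rewrite ?mulr0.
by rewrite mulr_sumr; apply: eq_bigr => j _; rewrite IHs mulrCA.
Qed.

(** Constraining [c] at every list is harmless: by [forms_exponent], only exponents of degree [m]
    matter once 0 is in [C]. *)
Definition forms C s m : @pset n k :=
  fun x => exists2 c, (forall l, C (c l)) & x = form_eval s m c.

Lemma forms_exponent C s m c : C 0 ->
  (forall l, is_exponent s m l -> C (c l)) -> forms C s m (form_eval s m c).
Proof.
move=> C0 Cc; exists (fun l => if is_exponent s m l then c l else 0).
  by move=> l; case: ifP => // /Cc.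
by apply: eq_form_eval => l ->.
Qed.

Lemma forms0 C s x : forms C s 0 x <-> C x.
Proof.
split=> [[c Cc ->]|Cx]; first by rewrite form_eval0.
by exists (fun=> x); rewrite ?form_eval0.
Qed.

Lemma formsS C f s m x : C 0 ->
  forms C (f :: s) m.+1 x <->
  exists y z, [/\ forms C s m.+1 y, forms C (f :: s) m z & x = y + f * z].
Proof.
move=> C0; split=> [[c Cc ->]|[y [z [[c Cc ->] [d Cd ->] ->]]]].
  rewrite form_evalS; exists (form_eval s m.+1 (fun l => c (0%N :: l))).
  exists (form_eval (f :: s) m (shift_coef c)); split=> //.
    by exists (fun l => c (0%N :: l)).
  by exists (shift_coef c) => // l; apply: Cc.
exists (fun l => if l is i :: l' then if i is j.+1 then d (j :: l') else c l'
                 else 0).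
  by case=> [|[|i] l].
by rewrite form_evalS.
Qed.

Lemma forms_is_ideal C s m : is_ideal C -> is_ideal (forms C s m).
Proof.
move=> hC; split.
  (* Written as [0 * 0] so that [form_evalZ] applies. *)
  exists (fun=> 0 * 0); first by move=> l; rewrite mul0r; apply: ideal0.
  by rewrite form_evalZ mul0r.
split=> [x y [c Cc ->] [d Cd ->]|a x [c Cc ->]].
  by exists (fun l => c l + d l); [move=> l; apply: idealD | rewrite form_evalD].
by exists (fun l => a * c l); [move=> l; apply: idealMl | rewrite form_evalZ].
Qed.

Lemma forms_mulgen C s m x t : is_ideal C ->
  forms C s m x -> gen_ideal s t -> forms C s m.+1 (x * t).
Proof.
move=> hC; have C0 := ideal0 hC; have hF s' m' := forms_is_ideal s' m' hC.
elim: s m x t => [|f s IHs] m x t.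
  by move=> _ /gen_nil->; rewrite mulr0; apply: ideal0.
move=> xF /gen_cons[b [u [su ->]]] {t}; rewrite mulrDr; apply: idealD => //.
  apply/formsS => //; exists 0, (x * b); split; [exact: ideal0| |by ring].
  exact: idealMr.
elim: m x xF => [|m IHm] x xF; apply/formsS => //.
  exists (x * u), 0; split; [|exact: ideal0|by rewrite mulr0 addr0].
  by apply: IHs => //; apply/forms0; move/forms0: xF.
move/formsS: xF => /(_ C0) [y [z [yF zF ->]]].
by exists (y * u), (z * u); split; [exact: IHs | exact: IHm | ring].
Qed.

Lemma mul_powP C s m x : is_ideal C ->
  ideal_mul C (ideal_pow (gen_ideal s) m) x <-> forms C s m x.
Proof.
move=> hC; have hF s' m' := forms_is_ideal s' m' hC; split.
  move: x; apply: mul_ind; first exact: ideal0.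
    by move=> x y; apply: idealD.
  move=> a + Ca; elim: m => [|m IHm] b.
    by move=> _; apply/forms0; apply: idealMr.
  move: b; apply: mul_ind; first by rewrite mulr0; apply: ideal0.
    by move=> u v uF vF; rewrite mulrDr; apply: idealD.
  by move=> u t mu st; rewrite mulrA; apply: forms_mulgen => //; apply: IHm.
(* The induction shortens the list while the ideal stays that of [s], hence the sublist [s']. *)
suff H : forall s', {subset s' <= s} -> forall c, (forall l, C (c l)) ->
    ideal_mul C (ideal_pow (gen_ideal s) m) (form_eval s' m c).
  by move=> [c Cc ->]; apply: H.
move=> s'; elim: s' m => [|f s' IHs] m sub c Cc /=.
  case: eqP => [->|_]; last exact: ideal_mul0.
  by rewrite -[c _]mulr1; apply: ideal_mulM.
have hM m' : is_ideal (ideal_mul C (ideal_pow (gen_ideal s) m')).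
  exact: mul_is_ideal.
apply: (big_ind (ideal_mul _ _)); first exact: ideal_mul0.
  by move=> u v; apply: ideal_mulD.
move=> j _; have fs : gen_ideal s f by apply/gen_mem/sub/mem_head.
have /IHs : {subset s' <= s} by move=> y y_s'; apply: sub; rewrite inE y_s' orbT.
move=> /(_ (m - j)%N (fun l => c (val j :: l)) (fun l => Cc _)).
move: (form_eval _ _ _); apply: mul_ind; first by rewrite mulr0; apply: ideal0.
  by move=> u v hu hv; rewrite mulrDr; apply: idealD.
move=> a b Ca mb; rewrite mulrCA; apply: ideal_mulM => //.
rewrite -[m in ideal_pow _ m](@subnKC j m) -1?ltnS //.
by apply: powM => //; apply: powX.
Qed.

Lemma powP s m x :
  ideal_pow (gen_ideal s) m x <-> exists c, x = form_eval s m c.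
Proof.
have hT : @is_ideal n k (fun=> True) by [].
split=> [mx|[c ->]].
  have /mul_powP-/(_ hT) [c _ ->] :
      ideal_mul (fun=> True) (ideal_pow (gen_ideal s) m) x.
    by rewrite -[x]mul1r; apply: ideal_mulM.
  by exists c.
have /mul_powP-/(_ hT) : forms (fun=> True) s m (form_eval s m c) by exists c.
move: (form_eval s m c); apply: mul_ind; first exact: ideal0 (pow_is_ideal _ _).
  by move=> x' y; apply: idealD (pow_is_ideal _ _).
by move=> a b _; apply: idealMl (pow_is_ideal _ _).
Qed.

(** * Regular sequences are quasi-regular *)

Definition nzdiv_mod f I := forall x, I (f * x) -> I x.

(* The regularity condition on [s] read from right to left. *)
Fixpoint rev_regular s : Prop :=
  if s is f :: s' then rev_regular s' /\ nzdiv_mod f (gen_ideal s') else True.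

(** Induction on [s], then on [m]. The hypothesis for the tail makes [f] a nonzerodivisor modulo
    each power of the tail ideal, so [f] cancels when two expansions along [f] are compared. *)
Lemma rees_quasi_regular s m c : rev_regular s ->
  ideal_pow (gen_ideal s) m.+1 (form_eval s m c) ->
  forall l, is_exponent s m l -> gen_ideal s (c l).
Proof.
have base s' c' : ideal_pow (gen_ideal s') 1 (form_eval s' 0 c') ->
    forall l, is_exponent s' 0 l -> gen_ideal s' (c' l).
  move/pow1 => /(_ (gen_is_ideal _)); rewrite form_eval0 => cs l.
  by case/andP=> /eqP sl /natnseq0P ->; rewrite sl.
elim: s m c => [|f s IHs] m c.
  case: m => [_|m _ _ [|? ?] //]; first exact: base.
case=> rs fs; have hs := gen_is_ideal s.
(* By induction on [t], [x] is a form of degree [t] in [s]. Quasi-regularity of [s] puts each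
   [f * d l] in [gen_ideal s], hence each [d l]. *)
have f_pow t x : ideal_pow (gen_ideal s) t (f * x) -> ideal_pow (gen_ideal s) t x.
  elim: t => // t IHt fx; have /powP[d xE] := IHt (pow_decr fx).
  rewrite xE in fx *; rewrite -form_evalZ in fx.
  have ds l : is_exponent s t l -> gen_ideal s (d l).
    by move=> sl; apply: fs; apply: IHs rs fx l sl.
  by apply: ideal_mulC; apply/mul_powP => //; apply: forms_exponent => //; apply: ideal0.
elim: m c => [|m IHm] c; first exact: base.
set c0 := fun l => c (0%N :: l).
case/powP=> d; rewrite form_evalS [form_eval _ m.+2 d]form_evalS -/c0.
set d0 := fun l => d (0%N :: l) => cdE.
(* Comparing the two expansions, [f] times the difference of the cofactors is a difference of forms
   in [s] alone, so [f] cancels. *)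
have /f_pow/powP[e eE] : ideal_pow (gen_ideal s) m.+1
    (f * (form_eval (f :: s) m (shift_coef c)
          - form_eval (f :: s) m.+1 (shift_coef d))).
  have -> : f * (form_eval (f :: s) m (shift_coef c)
                 - form_eval (f :: s) m.+1 (shift_coef d))
            = form_eval s m.+2 d0 - form_eval s m.+1 c0.
    by rewrite mulrBr -[f * form_eval _ m _](addKr (form_eval s m.+1 c0)) cdE; ring.
  apply: idealB; first exact: pow_is_ideal.
    by apply: pow_decr; apply/powP; exists d0.
  by apply/powP; exists c0.
have s_fs x : gen_ideal s x -> gen_ideal (f :: s) x.
  by apply: gen_sub => y sy; rewrite inE sy orbT.
(* The cofactor of [f] in the form of [c] now lies in the power [m.+1], so [IHm] settles the
   exponents in which [f] occurs. *)
have cS : forall l, is_exponent (f :: s) m l -> gen_ideal (f :: s) (shift_coef c l).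
  apply: IHm; rewrite -(subrK (form_eval (f :: s) m.+1 (shift_coef d)) (form_eval _ _ _)).
  rewrite eE; apply: idealD; first exact: pow_is_ideal.
    by apply: (pow_sub s_fs); apply/powP; exists e.
  by apply/powP; exists (shift_coef d).
(* Substituting [e] leaves an identity between forms in [s], and [IHs] settles the other exponents
   up to a multiple of [f]. *)
have c0S : forall l, is_exponent s m.+1 l -> gen_ideal s (c0 l + f * e l).
  apply: (IHs m.+1 (fun l => c0 l + f * e l) rs); rewrite form_evalD form_evalZ -eE.
  apply/powP; exists d0; rewrite mulrBr addrA cdE; ring.
case=> // [[|j] l] /andP[/eqP[sl] /eqP /= ml].
  have /c0S/s_fs c0f : is_exponent s m.+1 l by rewrite /is_exponent sl -ml add0n !eqxx.
  rewrite -[c _](addrK (f * e l)); apply: idealB => //; first exact: gen_is_ideal.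
  by apply: idealMr; [exact: gen_is_ideal | apply: gen_mem; rewrite mem_head].
apply: (cS (j :: l)); rewrite /is_exponent /= sl eqxx /=.
by rewrite -eqSS -ml.
Qed.

End IdealTheory.

(** * The Koszul complex modulo an ideal *)

Section Koszul.
Context {n : nat} {k : comNzRingType}.
Local Notation P := {mpoly k[n]}.
Implicit Types (I J Q : @pset n k) (s : seq P) (x y f : P).

(* The exterior algebra on a basis indexed by [s]; a pair [(a, b)] stands for
   [a + e_f b], where [e_f] is the basis vector of the head [f] of [s]. *)
Fixpoint koszul s : lmodType P :=
  if s is _ :: s' then (koszul s' * koszul s')%type else P^o.

(** The sign is that of the graded Leibniz rule: with d(e_f) = f, one has d(e_f b) = f b - e_f (d
    b). *)
Fixpoint koszul_diff s : koszul s -> koszul s :=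
  match s with
  | [::] => fun=> 0
  | f :: s' => fun z => (koszul_diff z.1 + f *: z.2, - koszul_diff z.2)
  end.

(* All the components of [z] of degree less than [i] vanish. *)
Fixpoint deg_ge s i : koszul s -> Prop :=
  match s with
  | [::] => fun z => i = 0%N \/ z = 0
  | f :: s' => fun z => deg_ge i z.1 /\ deg_ge i.-1 z.2
  end.

(** Chains over [P / Q] are treated as congruences modulo [Q], which avoids quotient modules. *)
Fixpoint coefs_in Q s : koszul s -> Prop :=
  match s with
  | [::] => fun z => Q z
  | f :: s' => fun z => coefs_in Q z.1 /\ coefs_in Q z.2
  end.

Lemma koszul_diffP s a (z w : koszul s) :
  koszul_diff (a *: z + w) = a *: koszul_diff z + koszul_diff w.
Proof.
elim: s z w => [|f s IHs] z w /=; first by rewrite scaler0 addr0.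
congr pair; rewrite IHs.
  by rewrite scalerDr addrACA scalerA mulrC -scalerA -scalerDr.
by rewrite opprD -scalerN.
Qed.

Lemma koszul_diffD s (z w : koszul s) :
  koszul_diff (z + w) = koszul_diff z + koszul_diff w.
Proof. by rewrite -[z]scale1r koszul_diffP !scale1r. Qed.

Lemma koszul_diff0 s : koszul_diff (0 : koszul s) = 0.
Proof. by apply: (addIr (koszul_diff (0 : koszul s))); rewrite -koszul_diffD !add0r. Qed.

Lemma koszul_diffZ s a (z : koszul s) :
  koszul_diff (a *: z) = a *: koszul_diff z.
Proof. by rewrite -[a *: z]addr0 koszul_diffP koszul_diff0 addr0. Qed.

Lemma koszul_diffN s (z : koszul s) : koszul_diff (- z) = - koszul_diff z.
Proof. by rewrite -scaleN1r koszul_diffZ scaleN1r. Qed.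

Lemma koszul_diffB s (z w : koszul s) :
  koszul_diff (z - w) = koszul_diff z - koszul_diff w.
Proof. by rewrite koszul_diffD koszul_diffN. Qed.

Lemma koszul_diffK s (z : koszul s) : koszul_diff (koszul_diff z) = 0.
Proof.
elim: s z => [|f s IHs] //= z; rewrite koszul_diffD koszul_diffZ !IHs.
by rewrite add0r scalerN subrr koszul_diffN IHs !oppr0.
Qed.

Lemma deg_geP s i a (z w : koszul s) :
  deg_ge i z -> deg_ge i w -> deg_ge i (a *: z + w).
Proof.
elim: s i z w => [|f s IHs] i z w /=.
  by case=> [->|->]; [left | case=> ->; [left | right; rewrite scaler0 addr0]].
by case=> ? ? [? ?]; split; apply: IHs.
Qed.

Lemma deg_ge0 s (z : koszul s) : deg_ge 0 z.
Proof. by elim: s z => [|f s IHs] z /=; [left | split]. Qed.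

Lemma deg_ge_zero s i : deg_ge i (0 : koszul s).
Proof. by elim: s i => [|f s IHs] i /=; [right | split; apply: IHs]. Qed.

Lemma deg_geZ s i a (z : koszul s) : deg_ge i z -> deg_ge i (a *: z).
Proof.
by move=> zi; rewrite -[_ *: _]addr0; apply: deg_geP => //; apply: deg_ge_zero.
Qed.

Lemma deg_geD s i (z w : koszul s) : deg_ge i z -> deg_ge i w -> deg_ge i (z + w).
Proof. by move=> zi wi; rewrite -[z]scale1r; apply: deg_geP. Qed.

Lemma deg_geB s i (z w : koszul s) : deg_ge i z -> deg_ge i w -> deg_ge i (z - w).
Proof. by move=> zi wi; rewrite -scaleN1r addrC; apply: deg_geP. Qed.

Lemma deg_ge_diff s i (z : koszul s) : deg_ge i z -> deg_ge i.-1 (koszul_diff z).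
Proof.
elim: s i z => [|f s IHs] i z /=; first by right.
case=> ? ?; split; first by apply: deg_geD; [apply: IHs | apply: deg_geZ].
by rewrite -scaleN1r; apply/deg_geZ/IHs.
Qed.

Lemma deg_ge_size s i (z : koszul s) : (size s < i)%N -> deg_ge i z -> z = 0.
Proof.
elim: s i z => [|f s IHs] i z /=; first by case: i => // i _ [].
case: i => // i si; case: z => a b /= [ai bi].
by rewrite (IHs _ _ (ltnW si) ai) (IHs _ _ si bi).
Qed.

Lemma coefs_inP Q s a (z w : koszul s) : is_ideal Q ->
  coefs_in Q z -> coefs_in Q w -> coefs_in Q (a *: z + w).
Proof.
move=> hQ; elim: s z w => [|f s IHs] z w /=.
  by move=> Qz Qw; apply: idealD => //; apply: idealMl.
by case=> ? ? [? ?]; split; apply: IHs.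
Qed.

Lemma coefs_in0 Q s : is_ideal Q -> coefs_in Q (0 : koszul s).
Proof. by move=> hQ; elim: s => [|f s IHs] /=; [apply: ideal0 | split]. Qed.

Lemma coefs_inZ Q s a (z : koszul s) : is_ideal Q ->
  coefs_in Q z -> coefs_in Q (a *: z).
Proof.
by move=> hQ Qz; rewrite -[_ *: _]addr0; apply: coefs_inP => //; apply: coefs_in0.
Qed.

Lemma coefs_inD Q s (z w : koszul s) : is_ideal Q ->
  coefs_in Q z -> coefs_in Q w -> coefs_in Q (z + w).
Proof. by move=> hQ Qz Qw; rewrite -[z]scale1r; apply: coefs_inP. Qed.

Lemma coefs_inB Q s (z w : koszul s) : is_ideal Q ->
  coefs_in Q z -> coefs_in Q w -> coefs_in Q (z - w).
Proof. by move=> hQ Qz Qw; rewrite -scaleN1r addrC; apply: coefs_inP. Qed.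

Lemma coefs_inN Q s (z : koszul s) : is_ideal Q ->
  coefs_in Q z -> coefs_in Q (- z).
Proof. by move=> hQ Qz; rewrite -scaleN1r; apply: coefs_inZ. Qed.

Lemma coefs_inS Q Q' s (z : koszul s) : (forall x, Q x -> Q' x) ->
  coefs_in Q z -> coefs_in Q' z.
Proof.
by move=> QQ'; elim: s z => [|f s IHs] z /=; [apply: QQ' | case; split; apply: IHs].
Qed.

Lemma coefs_in_mem Q s x (z : koszul s) : is_ideal Q -> Q x -> coefs_in Q (x *: z).
Proof.
move=> hQ Qx; elim: s z => [|f s IHs] z /=; first exact: idealMr.
by split; apply: IHs.
Qed.

Lemma coefs_in_diff Q s (z : koszul s) : is_ideal Q ->
  coefs_in Q z -> coefs_in Q (koszul_diff z).
Proof.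
move=> hQ; elim: s z => [|f s IHs] z /=; first by move=> _; apply: ideal0.
case=> ? ?; split; first by apply: coefs_inD => //; [apply: IHs | apply: coefs_inZ].
by apply: coefs_inN => //; apply: IHs.
Qed.

Lemma coefs_in_nzdiv Q s y (z : koszul s) : nzdiv_mod y Q ->
  coefs_in Q (y *: z) -> coefs_in Q z.
Proof.
move=> yQ; elim: s z => [|f s IHs] z /=; first exact: yQ.
by case; split; apply: IHs.
Qed.

(** That is, Q' = Q + (y), kept as a relation because [Q'] has its own description in each use. *)
Definition adjoined Q y Q' :=
  forall x, Q' x <-> exists a q, Q q /\ x = a * y + q.

Lemma coefs_in_adjoined Q y Q' s i (z : koszul s) : is_ideal Q -> adjoined Q y Q' ->
  coefs_in Q' z -> deg_ge i z ->
  exists u, deg_ge i u /\ coefs_in Q (z - y *: u).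
Proof.
move=> hQ hQ'; elim: s i z => [|f s IHs] i z /=.
  move=> /hQ'[a [q [Qq ->]]] [->|z0].
    exists (a : P^o); split; first by left.
    by rewrite [y *: _]mulrC [X in Q X]addrC addKr.
  (* A coefficient forced to vanish gets the quotient 0, so [u] keeps the degree bound of [z]. *)
  exists 0; split; first by right.
  by rewrite z0 scaler0 subr0; apply: ideal0.
case=> /IHs h1 /IHs h2 [/h1[u [ui Qu]] /h2[v [vi Qv]]].
by exists (u, v).
Qed.

(* The homotopy is left multiplication by [\sum a_f e_f], where
   [y = \sum a_f f]. *)
Lemma koszul_homotopy s y : gen_ideal s y ->
  exists h : koszul s -> koszul s,
    [/\ forall z, koszul_diff (h z) = y *: z - h (koszul_diff z),
        forall i z, deg_ge i z -> deg_ge i.+1 (h z)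
      & forall Q z, is_ideal Q -> coefs_in Q z -> coefs_in Q (h z)].
Proof.
(* Linearity is added for the induction, which applies the homotopy of the tail to sums. *)
suff H : gen_ideal s y -> exists h : koszul s -> koszul s,
    [/\ forall a z w, h (a *: z + w) = a *: h z + h w,
        forall z, koszul_diff (h z) = y *: z - h (koszul_diff z),
        forall i z, deg_ge i z -> deg_ge i.+1 (h z)
      & forall Q z, is_ideal Q -> coefs_in Q z -> coefs_in Q (h z)].
  by move=> /H[h [_ h1 h2 h3]]; exists h.
elim: s y => [|f s IHs] y.
  move/gen_nil->; exists (fun=> 0); split => //=.
  - by move=> *; rewrite scaler0 addr0.
  - by move=> z; rewrite scale0r subr0.
  - by move=> *; right.
  by move=> Q z hQ _; apply: ideal0.
case/gen_cons=> a [y' [/IHs[h [hP hd hi hc]] ->]].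
have h0 : h 0 = 0 by apply: (addIr (h 0)); rewrite -{1}[h 0]scale1r -hP scaler0 !add0r.
(* If [h] is multiplication by w, then (a e_f + w)(u + e_f v) = w u + e_f (a u - w v), since w and
   e_f anticommute. *)
exists (fun z => (h z.1, a *: z.1 - h z.2)); split.
- move=> b z w /=; congr pair; rewrite hP //.
  by rewrite scalerDr scalerA mulrC -scalerA opprD addrACA -scalerBr.
- move=> [u v] /=; congr pair.
    rewrite hd scalerBr addrACA scalerA -scalerDl -opprD [f * a]mulrC [y' + _]addrC.
    by rewrite [h _ + _]addrC -hP [f *: v + _]addrC.
  have hN z : h (- z) = - h z.
    by rewrite -[X in h X]addr0 -scaleN1r hP h0 addr0 scaleN1r.
  transitivity ((a * f + y') *: v
                - (a *: (koszul_diff u + f *: v) - h (- koszul_diff v))); last by [].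
  rewrite koszul_diffB koszul_diffZ hd hN opprK scalerDl scalerDr scalerA.
  rewrite [a *: koszul_diff u + _ *: v]addrC -[_ + _ + h _]addrA.
  rewrite [in RHS]opprD addrACA subrr add0r.
  by rewrite !opprD !opprK addrC addrAC addrA.
- move=> i [u v] /= [ui vi]; split; first exact: hi.
  apply: deg_geB; first exact: deg_geZ.
  by case: i ui vi => [|i] ui vi; [apply: deg_ge0 | apply: hi].
move=> Q [u v] hQ /= [Qu Qv]; split; first exact: hc.
by apply: coefs_inB => //; [apply: coefs_inZ | apply: hc].
Qed.

(** Vanishing of the Koszul homology H_i(s; P/Q) for all i >= a. Bounds on degrees replace
    homogeneous components. *)
Definition koszul_acyclic s Q a :=
  forall i z, (a <= i)%N -> @deg_ge s i z -> coefs_in Q (koszul_diff z) ->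
  exists v, deg_ge i.+1 v /\ coefs_in Q (z - koszul_diff v).

Lemma koszul_acyclic_size s Q a : is_ideal Q -> (size s < a)%N ->
  koszul_acyclic s Q a.
Proof.
move=> hQ sa i z ai zi _; exists 0; split; first exact: deg_ge_zero.
rewrite (deg_ge_size (leq_trans sa ai) zi); rewrite koszul_diff0 subr0.
exact: coefs_in0.
Qed.

(* Multiplication by [y] is zero on the homology with coefficients in [P / Q]. *)
Lemma koszul_acyclic_descent s Q Q' y a : is_ideal Q -> is_ideal Q' ->
  adjoined Q y Q' -> nzdiv_mod y Q -> gen_ideal s y ->
  koszul_acyclic s Q' a.+1 -> koszul_acyclic s Q a.
Proof.
move=> hQ hQ' adj yQ /koszul_homotopy[h [hd hi hc]] acyc i z ai zi dz.
have QQ' x : Q x -> Q' x by move=> Qx; apply/adj; exists 0, x; rewrite mul0r add0r.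
have Qy : Q' y by apply/adj; exists 1, 0; rewrite mul1r addr0; split=> //; apply: ideal0.
(* As d(h z) = y z - h (d z), [h z] is a cycle modulo [Q'], so h z = d v + y u modulo [Q]. Applying
   d gives y z = y (d u) modulo [Q], and [y] cancels. *)
have [|v [vi hv]] := acyc i.+1 (h z) ai (hi _ _ zi).
  rewrite hd; apply: coefs_inB => //; first exact: coefs_in_mem.
  by apply: hc => //; apply: coefs_inS QQ' dz.
have hvi : deg_ge i.+1 (h z - koszul_diff v).
  by apply: deg_geB; [exact: hi | exact: deg_ge_diff vi].
have [u [ui Qu]] := coefs_in_adjoined hQ adj hv hvi.
exists u; split=> //; apply: (coefs_in_nzdiv yQ).
have := coefs_in_diff hQ Qu; rewrite 2!koszul_diffB koszul_diffK subr0 hd koszul_diffZ.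
move=> Qd; rewrite scalerBr -(subrK (h (koszul_diff z)) (_ - _)).
by rewrite [_ - _ - _]addrAC; apply: coefs_inD => //; apply: hc.
Qed.

(** The long exact sequence of multiplication by [y] on P/Q, by hand: if d z = y u modulo [Q], then
    [u] is a cycle, hence d v modulo [Q], and z - y v is a cycle modulo [Q]. *)
Lemma koszul_acyclic_adjoin s Q Q' y a : is_ideal Q ->
  adjoined Q y Q' -> nzdiv_mod y Q ->
  koszul_acyclic s Q a -> koszul_acyclic s Q' a.+1.
Proof.
move=> hQ adj yQ acyc [//|i] z ai zi dz.
have [u [ui Qu]] := coefs_in_adjoined hQ adj dz (deg_ge_diff zi).
have [|v [vi Qv]] := acyc i u ai ui.
  apply: (coefs_in_nzdiv yQ); have := coefs_in_diff hQ Qu.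
  rewrite koszul_diffB koszul_diffK koszul_diffZ sub0r => /(coefs_inN hQ).
  by rewrite opprK.
have [|||t [ti Qt]] := acyc i.+1 (z - y *: v).
- exact: leqW.
- by apply: deg_geB => //; apply: deg_geZ.
- rewrite koszul_diffB koszul_diffZ -(subrK (y *: u) (koszul_diff z)) -addrA -scalerBr.
  by apply: coefs_inD => //; apply: coefs_inZ.
exists t; split=> //; rewrite -(subrK (y *: v) z) addrAC.
have hQ' : is_ideal Q'.
  split; first by apply/adj; exists 0, 0; rewrite mul0r addr0; split=> //; apply: ideal0.
  split=> [b c /adj[b1 [b2 [Qb ->]]] /adj[c1 [c2 [Qc ->]]]|b c /adj[c1 [c2 [Qc ->]]]].
    by apply/adj; exists (b1 + c1), (b2 + c2); split; [exact: idealD | ring].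
  by apply/adj; exists (b * c1), (b * c2); split; [exact: idealMl | ring].
apply: coefs_inD => //.
  by apply: coefs_inS Qt => x Qx; apply/adj; exists 0, x; rewrite mul0r add0r.
apply: coefs_in_mem => //; apply/adj; exists 1, 0.
by rewrite mul1r addr0; split=> //; apply: ideal0.
Qed.

(** Modulo [Q] the vector e_f has zero differential, so a cycle z for [s] gives the cycle e_f z, one
    degree higher. *)
Lemma koszul_acyclic_behead f s Q a : is_ideal Q -> Q f ->
  koszul_acyclic (f :: s) Q a.+1 -> koszul_acyclic s Q a.
Proof.
move=> hQ Qf acyc i z ai zi dz.
have [||[v1 v2] [[/= v1i v2i] [/= _ Qv]]] := acyc i.+1 (0, z) ai.
- by split => //=; apply: deg_ge_zero.
- split=> /=; last exact: coefs_inN.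
  by rewrite koszul_diff0 add0r; apply: coefs_in_mem.
exists (- v2); split; first by rewrite -scaleN1r; apply: deg_geZ.
by rewrite koszul_diffN.
Qed.

Lemma koszul_acyclic_catr s t Q a : is_ideal Q -> {in s, forall f, Q f} ->
  koszul_acyclic (s ++ t) Q (size s + a) -> koszul_acyclic t Q a.
Proof.
move=> hQ; elim: s => //= f s IHs sQ acyc.
apply: IHs => [g sg|]; first by apply: sQ; rewrite inE sg orbT.
by apply: koszul_acyclic_behead acyc => //; apply: sQ; rewrite mem_head.
Qed.

(** Let z be the product of all basis vectors. Then x z is a cycle modulo [Q] in top degree, where
    there are no boundaries, so x z vanishes modulo [Q]. *)
Lemma koszul_top s Q x : is_ideal Q -> koszul_acyclic s Q (size s) ->
  (forall f, f \in s -> Q (x * f)) -> Q x.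
Proof.
move=> hQ acyc xs.
have [z [zi zd zx]] : exists z : koszul s, [/\ deg_ge (size s) z,
    coefs_in Q (koszul_diff (x *: z)) & coefs_in Q (x *: z) -> Q x].
  elim: s xs {acyc} => [|f s IHs] xs.
    by exists 1; split=> /=; [left | apply: ideal0 | rewrite [x *: _]mulr1].
  have [|z [zi zd zx]] := IHs; first by move=> g sg; apply: xs; rewrite inE sg orbT.
  have Qxf : Q (f * x) by rewrite mulrC; apply: xs; rewrite mem_head.
  exists (0, z); split=> [|/=|[_ /zx//]]; first by split=> //; apply: deg_ge_zero.
  split; last exact: coefs_inN.
  by rewrite scaler0 koszul_diff0 add0r scalerA; apply: coefs_in_mem.
have [v [vi]] := acyc _ _ (leqnn _) (deg_geZ x zi) zd.
by rewrite (deg_ge_size (ltnSn _) vi) koszul_diff0 subr0.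
Qed.

Fixpoint koszul_const s x : koszul s :=
  match s with
  | [::] => x
  | f :: s' => (koszul_const s' x, 0)
  end.

Fixpoint const_coef s : koszul s -> P :=
  match s with
  | [::] => fun z => z
  | f :: s' => fun z => const_coef z.1
  end.

(** If x is the sum of the a_f f, take for z the sum of the a_f e_f. *)
Lemma gen_diff s x : gen_ideal s x -> exists z,
  deg_ge 1 z /\ koszul_diff z = koszul_const s x.
Proof.
elim: s x => [|f s IHs] x.
  by move/gen_nil->; exists 0; split; first by right.
case/gen_cons=> a [y [/IHs[z [zi zd]] ->]].
exists (z, koszul_const s a); split; first by split=> //; apply: deg_ge0.
rewrite /= zd; congr pair.
  elim: s {IHs z zi zd} => [|g s IHs] /=; first by rewrite [f *: _]mulrC addrC.
  congr pair; first exact: IHs.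
  by transitivity ((0 : koszul s) + f *: 0); last rewrite scaler0 addr0.
suff -> : koszul_diff (koszul_const s a) = 0 by rewrite oppr0.
elim: s {IHs z zi zd} => //= g s ->.
by rewrite scaler0 addr0 koszul_diff0 oppr0.
Qed.

(** The constant part of d z is the sum of the f b_f, with b_f the coefficient of e_f in [z]. *)
Lemma const_coef_diff Q s (z : koszul s) : is_ideal Q -> coefs_in Q z ->
  ideal_mul Q (gen_ideal s) (const_coef (koszul_diff z)).
Proof.
have mem_coef t (w : koszul t) : coefs_in Q w -> Q (const_coef w).
  by elim: t w => //= f t IHt w [/IHt].
have coefD t (w w' : koszul t) : const_coef (w + w') = const_coef w + const_coef w'.
  by elim: t w w' => //= f t IHt w w'; rewrite -IHt.
have coefZ t a (w : koszul t) : const_coef (a *: w) = a * const_coef w.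
  by elim: t w => //= f t IHt w; rewrite -IHt.
move=> hQ; elim: s z => [|f s IHs] z /=; first by move=> _; apply: ideal_mul0.
case=> /IHs Qz1 /mem_coef Qz2; rewrite coefD coefZ; apply: ideal_mulD.
  by apply: ideal_mulS Qz1 => // x; apply: gen_sub => y sy; rewrite inE sy orbT.
by rewrite mulrC; apply: ideal_mulM => //; apply: gen_mem; rewrite mem_head.
Qed.

(** Write x = d z. As x is in [Q], z is a cycle modulo [Q], hence z = d v + w with w over [Q], and x
    = d w. *)
Lemma koszul_cap_mul s Q x : is_ideal Q -> koszul_acyclic s Q 1 ->
  Q x -> gen_ideal s x -> ideal_mul Q (gen_ideal s) x.
Proof.
move=> hQ acyc Qx /gen_diff[z [zi zd]].
have [|v [_ Qv]] := acyc 1%N z (leqnn _) zi.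
  rewrite zd; elim: {z zi zd acyc} s => //= f s IHs.
  by split=> //; apply: coefs_in0.
have := const_coef_diff hQ Qv; rewrite koszul_diffB koszul_diffK subr0 zd.
by suff -> : const_coef (koszul_const s x) = x by []; elim: {z zi zd acyc v Qv} s.
Qed.

End Koszul.

(** * Acyclicity from powers of the variables *)

Section Acyclicity.
Context {n : nat} {k : comNzRingType}.
Local Notation P := {mpoly k[n]}.
Implicit Types (s t : seq P) (x y f : P) (N j : nat) (m : 'X_{1..n}).

Definition var_pow_mnm N j m := [exists i : 'I_n, (i < j)%N && (N <= m i)%N].

(* The ideal generated by the [N]-th powers of the first [j] variables. *)
Definition var_pow_ideal N j : @pset n k :=
  fun x => {in msupp x, forall m, var_pow_mnm N j m}.

Lemma var_pow_is_ideal N j : is_ideal (var_pow_ideal N j).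
Proof.
split; first by move=> m; rewrite msupp0.
split=> [x y hx hy m /msuppD_le|x y hy m /msuppM_le/allpairsP[[m1 m2]]].
  by rewrite mem_cat => /orP[/hx|/hy].
case=> /= _ /hy/existsP[i /andP[ij Ni]] ->; apply/existsP; exists i.
by rewrite ij mnmDE (leq_trans Ni) ?leq_addl.
Qed.

Lemma var_pow_ideal0 N : var_pow_ideal N 0 = gen_ideal [::].
Proof.
apply: functional_extensionality => x; apply: propositional_extensionality; split.
  move=> hx; apply/gen_nil/msuppnil0; case E: (msupp x) => [//|m l].
  by have := hx m; rewrite E mem_head => /(_ isT)/existsP[i].
by move/gen_nil->; apply: ideal0 (var_pow_is_ideal N 0).
Qed.

Lemma var_pow_adjoined N (j : 'I_n) :
  adjoined (var_pow_ideal N j) ('X_j ^+ N) (var_pow_ideal N j.+1).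
Proof.
have hI i := var_pow_is_ideal N i.
move=> x; split=> [hx|[a [q [hq ->]]]]; last first.
  apply: (idealD (hI _)); last first.
    move=> m /hq/existsP[i /andP[ij Ni]]; apply/existsP; exists i.
    by rewrite Ni ltnW.
  apply: (idealMl _ (hI _)) => m; rewrite mpolyXn msuppX inE => /eqP->.
  by apply/existsP; exists j; rewrite ltnSn mulmnE mnm1E eqxx mul1n leqnn.
(* The monomials outside the smaller ideal are divisible by ['X_j ^+ N]. *)
exists (\sum_(m <- msupp x | ~~ var_pow_mnm N j m) x@_m *: 'X_[m - U_(j) *+ N]).
exists (\sum_(m <- msupp x | var_pow_mnm N j m) x@_m *: 'X_[m]); split.
  apply: (big_ind (var_pow_ideal N j)); first exact: ideal0.
    by move=> u v; apply: idealD.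
  by move=> m hm m' /msuppZ_le; rewrite msuppX inE => /eqP->.
rewrite {1}[x]mpolyE (bigID (var_pow_mnm N j)) /= addrC; congr (_ + _).
rewrite mulr_suml big_seq_cond [RHS]big_seq_cond; apply: eq_bigr => m /andP[xm nm].
rewrite -scalerAl mpolyXn -mpolyXD submK //; apply/mnm_lepP => i.
rewrite mulmnE mnm1E; case: eqP => // <-; rewrite mul1n.
have /existsP[i' /andP[]] := hx m xm; rewrite ltnS leq_eqVlt => /orP[|ij Ni].
  by move/eqP/val_inj->.
by case/negP: nm; apply/existsP; exists i'; rewrite ij.
Qed.

(** Multiplying by a power of ['X_j] leaves the exponents of the earlier variables unchanged. *)
Lemma var_pow_nzdiv N (j : 'I_n) : nzdiv_mod ('X_j ^+ N) (var_pow_ideal N j).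
Proof.
move=> x hx m xm.
have /hx/existsP[i /andP[ij]] : (U_(j) *+ N + m)%MM \in msupp ('X_j ^+ N * x).
  by rewrite mpolyXn mulrC mcoeff_msupp mcoeffMX -mcoeff_msupp.
rewrite mnmDE mulmnE mnm1E; case: eqP ij => [->|_ ij]; first by rewrite ltnn.
by rewrite mul0n => Ni; apply/existsP; exists i; rewrite ij.
Qed.

(** Modulo the powers of all [n] variables, the bound [n.+1] exceeds the length of [s]. Dropping the
    powers one at a time lowers the bound by one each, by [koszul_acyclic_descent]. *)
Lemma koszul_acyclic_var_pow s N : size s = n ->
  (forall i : 'I_n, gen_ideal s ('X_i ^+ N)) -> koszul_acyclic s (gen_ideal [::]) 1.
Proof.
move=> sn hX; rewrite -(var_pow_ideal0 N).
suff H d : (d <= n)%N -> koszul_acyclic s (var_pow_ideal N (n - d)) (n - d).+1.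
  by have := H n (leqnn n); rewrite subnn.
have hI i := var_pow_is_ideal N i.
elim: d => [|d IHd] dn.
  by rewrite subn0; apply: koszul_acyclic_size; rewrite // sn.
have jn : (n - d.+1 < n)%N by rewrite ltn_subrL (leq_trans _ dn).
apply: koszul_acyclic_descent (var_pow_adjoined N (Ordinal jn)) _ _ _ => //.
  exact: var_pow_nzdiv.
by rewrite /= subnSK //; apply: IHd; apply: ltnW.
Qed.

Lemma koszul_acyclic_regular s t : rev_regular t ->
  koszul_acyclic s (gen_ideal [::]) 1 -> koszul_acyclic s (gen_ideal t) (size t).+1.
Proof.
move=> + acyc; elim: t => //= f t IHt [/IHt acyct ft].
apply: koszul_acyclic_adjoin ft acyct; first exact: gen_is_ideal.
by move=> x; apply: gen_cons.
Qed.

(** Passing from P to P/(s) raises the bound for [s ++ t] from 1 to [size s + 1]. Since [s] is zero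
    in P/(s), removing it from the sequence lowers the bound by [size s]. *)
Lemma koszul_acyclic_transverse s t N : rev_regular s ->
  (size s + size t)%N = n ->
  (forall i : 'I_n, ideal_sum (gen_ideal s) (gen_ideal t) ('X_i ^+ N)) ->
  koszul_acyclic t (gen_ideal s) 1.
Proof.
move=> rs st hX; have hI := gen_is_ideal.
apply: (koszul_acyclic_catr (hI n k s) (@gen_mem _ _ s)).
rewrite addn1; apply: koszul_acyclic_regular => //.
apply: (koszul_acyclic_var_pow (N := N)); first by rewrite size_cat.
move=> i; have [a [b [sa [tb ->]]]] := hX i.
by apply: idealD => //; [move: sa | move: tb]; apply: gen_sub => y yy;
  rewrite mem_cat yy ?orbT.
Qed.

End Acyclicity.

(** * Finite generation and associated primes *)

(** The family [F0] for the first [d] coordinates fails only for elements whose last coordinate is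
    below the maximum over [F0]. Each of these finitely many values gives a slice covered by
    induction. *)
Lemma dickson (X : eqType) (e : X -> nat -> nat) d (S : X -> Prop) :
  exists F : seq X, {in F, forall u, S u} /\
    forall u, S u -> exists2 v, v \in F & forall i, (i < d)%N -> (e v i <= e u i)%N.
Proof.
elim: d S => [|d IHd] S.
  have [[u Su]|nS] := classic (exists u, S u); last first.
    by exists [::]; split=> // u Su; case: nS; exists u.
  by exists [:: u]; split=> [v /[!inE]/eqP->//|v _]; exists u; rewrite ?inE.
have [F0 [F0S F0P]] := IHd S.
have [F1 [F1S F1P]] : exists F : seq X, {in F, forall u, S u} /\
    forall u, S u -> (e u d < \max_(v <- F0) e v d)%N ->
    exists2 v, v \in F & forall i, (i < d.+1)%N -> (e v i <= e u i)%N.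
  elim: (\max_(v <- F0) _)%N => [|b [F [FS FP]]]; first by exists [::].
  have [G [GS GP]] := IHd (fun u => S u /\ e u d = b).
  exists (G ++ F); split=> [u|u Su].
    by rewrite mem_cat => /orP[/GS[]|/FS].
  rewrite ltnS leq_eqVlt => /orP[/eqP ub|/(FP u Su)[v vF vu]]; last first.
    by exists v; rewrite ?mem_cat ?vF ?orbT.
  have [v vG vu] := GP u (conj Su ub); exists v; first by rewrite mem_cat vG.
  move=> i; rewrite ltnS leq_eqVlt => /orP[/eqP->|]; last exact: vu.
  by have [_ ->] := GS v vG; rewrite ub.
exists (F0 ++ F1); split=> [u|u Su].
  by rewrite mem_cat => /orP[/F0S|/F1S].
have [v vF vu] := F0P u Su.
have [le_vu|lt_uv] := leqP (e v d) (e u d).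
  exists v; first by rewrite mem_cat vF.
  by move=> i; rewrite ltnS leq_eqVlt => /orP[/eqP->|/vu].
have [|w wF wu] := F1P u Su; last by exists w; rewrite // mem_cat wF orbT.
by rewrite (leq_trans lt_uv) // (big_rem v) //= leq_maxl.
Qed.

Section Noetherian.
Context {n : nat} {k : fieldType}.
Local Notation P := {mpoly k[n]}.
Implicit Types (I J p : @pset n k) (s : seq P) (x y f : P).

(** Dickson's lemma on leading exponents provides the generators, and division cancels leading terms
    one by one. *)
Lemma hilbert_basis J : is_ideal J -> exists s, forall x, J x <-> gen_ideal s x.
Proof.
move=> hJ.
have [s [sJ sP]] := dickson (fun (x : P) i => nth 0%N (mlead x) i) n
                            (fun x => J x /\ x != 0).
have {}sP x : J x -> x != 0 -> exists2 y, y \in s & (mlead y <= mlead x)%MM.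
  move=> Jx x0; have [y sy yx] := sP x (conj Jx x0); exists y => //.
  by apply/mnm_lepP => i; rewrite !(mnm_nth 0%N); apply: yx.
exists s => x; split; last by apply: gen_min => // y /sJ[].
elim/mleadrect: x => x IHx Jx.
have [->|x0] := eqVneq x 0; first exact: ideal0 (gen_is_ideal s).
have [y sy yx] := sP x Jx x0; have [Jy y0] := sJ y sy.
pose r := (mleadc x / mleadc y) *: ('X_[mlead x - mlead y] * y).
have sr : gen_ideal s r.
  by rewrite /r -mul_mpolyC mulrA; apply: idealMl (gen_is_ideal s) (gen_mem sy).
rewrite -(subrK r x); apply: idealD => //; first exact: gen_is_ideal.
have c0 : mleadc x / mleadc y != 0 by rewrite mulf_neq0 ?invr_eq0 ?mleadc_eq0.
have X0 : 'X_[mlead x - mlead y] != 0 :> P by rewrite -msupp_eq0 msuppX.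
have rx : mlead r = mlead x by rewrite /r mleadZ // mleadM // mleadXm submK.
have [->|xr0] := eqVneq (x - r) 0; first exact: ideal0 (gen_is_ideal s).
apply: IHx; last first.
  apply: idealB => //; rewrite /r -mul_mpolyC mulrA.
  exact: idealMl.
rewrite lt_neqAle; apply/andP; split.
  apply/negP => /eqP E; move: xr0; rewrite -mleadc_eq0 E mcoeffB.
  suff -> : r@_(mlead x) = mleadc x by rewrite subrr eqxx.
  rewrite -[X in r@_X]rx /r mleadcZE mleadM // mleadcM mleadXm mcoeffX eqxx mul1r.
  by rewrite divfK ?mleadc_eq0.
by apply: le_trans (mleadB_le _ _) _; rewrite rx joinxx.
Qed.

(** Among the ideals (I : u) containing (I : x), with u outside [I], a maximal one is prime. If no
    suitable prime exists, [nxt] builds a strictly ascending chain. *)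
Lemma assoc_prime_exists I x : is_ideal I -> ~ I x ->
  exists2 p, assoc_prime I p & forall g, I (g * x) -> p g.
Proof.
move=> hI Ix; apply: NNPP => noP.
pose T := {u : P | ~ I u /\ forall g, I (g * x) -> I (g * u)}.
have nxtP (t : T) : exists t' : T, (forall g, I (g * sval t) -> I (g * sval t')) /\
    exists2 g, I (g * sval t') & ~ I (g * sval t).
  case: t => u [Iu xu] /=; apply: NNPP => maxu; apply: noP.
  exists (fun g => I (g * u)) => //; split; last by exists u.
  split; first split.
  - by rewrite mul0r; apply: ideal0.
  - split=> [a b ? ?|a b ?]; first by rewrite mulrDl; apply: idealD.
    by rewrite -mulrA; apply: idealMl.
  split=> [|a b abu]; first by rewrite mul1r.
  (* If b u is outside [I], maximality of (I : u) forces (I : b u) = (I : u), which contains a. *)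
  have [bu|bu] := classic (I (b * u)); [by right | left].
  apply: NNPP => au; apply: maxu.
  have hb : ~ I (b * u) /\ forall g, I (g * x) -> I (g * (b * u)).
    by split=> // g /xu gu; rewrite mulrCA; apply: idealMl.
  exists (exist _ (b * u) hb); split=> [g gu|] /=.
    by rewrite mulrCA; apply: idealMl.
  by exists a; rewrite // mulrA.
pose nxt t := proj1_sig (constructive_indefinite_description _ (nxtP t)).
have nxt_sub t g : I (g * sval t) -> I (g * sval (nxt t)).
  by have [h _] := proj2_sig (constructive_indefinite_description _ (nxtP t)); apply: h.
have nxt_lt t : exists2 g, I (g * sval (nxt t)) & ~ I (g * sval t).
  by have [] := proj2_sig (constructive_indefinite_description _ (nxtP t)).
have hx : ~ I x /\ forall g, I (g * x) -> I (g * x) by [].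
pose u j := iter j nxt (exist _ x hx).
have u_mono i j g : (i <= j)%N -> I (g * sval (u i)) -> I (g * sval (u j)).
  move=> /subnKC<-; elim: (j - i)%N => [|d IHd]; first by rewrite addn0.
  by rewrite addnS => /IHd/nxt_sub.
have [|s sJ] := @hilbert_basis (fun g => exists j, I (g * sval (u j))).
  split; first by exists 0%N; rewrite mul0r; apply: ideal0.
  split=> [a b [i ai] [j bj]|a b [j bj]]; last first.
    by exists j; rewrite -mulrA; apply: idealMl.
  exists (maxn i j); rewrite mulrDl; apply: idealD => //.
    by apply: u_mono ai; apply: leq_maxl.
  by apply: u_mono bj; apply: leq_maxr.
(* The union of the chain is finitely generated, so it is reached at some stage [N]. *)
have [N sN] : exists N, {in s, forall g, I (g * sval (u N))}.
  have: {in s, forall g, exists j, I (g * sval (u j))} by move=> g /gen_mem/sJ.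
  elim: (s) => [|f t IHt] ft; first by exists 0%N.
  have [g gt|N tN] := IHt; first by apply: ft; rewrite inE gt orbT.
  have [j fj] := ft f (mem_head f t); exists (maxn N j) => g; rewrite inE.
  case/orP=> [/eqP->|/tN]; first by apply: u_mono fj; apply: leq_maxr.
  by apply: u_mono; apply: leq_maxl.
have [g gN1 gN] := nxt_lt (u N); apply: gN.
have: gen_ideal s g by apply/sJ; exists N.+1.
suff : forall g, gen_ideal s g -> I (g * sval (u N)) by apply.
apply: gen_min => //; split; first by rewrite mul0r; apply: ideal0.
split=> [a b ? ?|a b ?]; first by rewrite mulrDl; apply: idealD.
by rewrite -mulrA; apply: idealMl.
Qed.

End Noetherian.

(** * Symbolic powers of a transverse intersection *)

Section SymbolicPowers.
Context {n : nat} {k : fieldType}.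
Local Notation P := {mpoly k[n]}.
Implicit Types (I J p : @pset n k) (s t : seq P) (x y f : P).

Lemma pset_ext I J : set_eq I J -> I = J.
Proof.
move=> IJ; apply: functional_extensionality => x.
exact: propositional_extensionality.
Qed.

(** The power of [I] containing [x] is raised step by step: a coefficient of [x] outside [I] would
    yield an associated prime of the intersection at which the condition on [x] fails. *)
Lemma symbolic_pow_sub s J m x : rev_regular s -> is_ideal J ->
  (forall y, (forall z, J z -> gen_ideal s (y * z)) -> gen_ideal s y) ->
  symbolic_pow (ideal_cap (gen_ideal s) J) m x -> ideal_pow (gen_ideal s) m x.
Proof.
move=> rs hJ colon xm; set I := gen_ideal s; have hI : is_ideal I by apply: gen_is_ideal.
suff H j : (j <= m)%N -> ideal_pow I j x by apply: H.
elim: j => // j IHj jm; have /powP[c xE] := IHj (ltnW jm).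
apply: NNPP => xj.
have [l [sl cl]] : exists l, is_exponent s j l /\ ~ I (c l).
  apply: NNPP => nc; apply: xj; apply: ideal_mulC; apply/mul_powP => //.
  rewrite xE; apply: forms_exponent => [|l sl]; first exact: ideal0.
  by apply: NNPP => cl; apply: nc; exists l.
have [p [[hp [p1 pM]] [u pE]] clp] := assoc_prime_exists hI cl.
have Iu : ~ I u by move=> Iu; apply: p1; apply/pE; rewrite mul1r.
(* If [J] were inside p = (I : u), the colon hypothesis would put [u] in [I]. With such a [b], p is
   also the annihilator of b u modulo the intersection. *)
have [b Jb pb] : exists2 b, J b & ~ p b.
  apply: NNPP => Jp; apply: Iu; apply: colon => z Jz; rewrite mulrC; apply/pE.
  by apply: NNPP => pz; apply: Jp; exists z.
have [|z [pz zx]] := xm p.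
  split=> //; exists (b * u) => g; split=> [gp|[gbu _]].
    split; first by rewrite mulrCA; apply: idealMl => //; apply/pE.
    by rewrite mulrA; apply: idealMr => //; apply: idealMl.
  have /pM[//|pb'] : p (g * b) by apply/pE; rewrite -mulrA.
  by case: pb.
apply: pz; apply: clp.
apply: (rees_quasi_regular (c := fun l => z * c l) rs _ sl).
rewrite form_evalZ -xE; apply: (pow_leq jm).
by apply: pow_sub zx => y [].
Qed.

(** By induction [x] is a form with coefficients in [J]. Quasi-regularity puts them in the ideal of
    [s] too, hence in the product, which supplies the extra factor. *)
Lemma pow_cap_mul s J m x : rev_regular s -> is_ideal J ->
  (forall y, gen_ideal s y -> J y -> ideal_mul J (gen_ideal s) y) ->
  ideal_pow (gen_ideal s) m x -> J x -> ideal_mul J (ideal_pow (gen_ideal s) m) x.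
Proof.
move=> rs hJ capJ; elim: m x => [|m IHm] x xm Jx.
  by rewrite -[x]mulr1; apply: ideal_mulM.
have /mul_powP-/(_ hJ) [c Jc xE] := IHm x (pow_decr xm) Jx.
have cs l : is_exponent s m l -> ideal_mul J (gen_ideal s) (c l).
  by move=> sl; apply: capJ => //; apply: rees_quasi_regular sl; rewrite -?xE.
have hM : is_ideal (ideal_mul J (gen_ideal s)) by apply: mul_is_ideal.
have := forms_exponent (ideal0 hM) cs; rewrite -xE => /mul_powP-/(_ hM).
move: {xm Jx xE} x; apply: mul_ind; first exact: ideal_mul0.
  by move=> u v; apply: ideal_mulD.
move=> a b + mb; move: a; apply: mul_ind; first by rewrite mul0r; apply: ideal_mul0.
  by move=> u v hu hv; rewrite mulrDl; apply: ideal_mulD.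
by move=> u v Ju sv; rewrite -mulrA [v * b]mulrC; do 2?apply: ideal_mulM.
Qed.

Lemma symbolic_pow_transverse s t N m :
  rev_regular s -> rev_regular t -> (0 < size s)%N -> (0 < size t)%N ->
  (size s + size t)%N = n ->
  (forall i : 'I_n, ideal_sum (gen_ideal s) (gen_ideal t) ('X_i ^+ N)) ->
  set_eq (ideal_pow (ideal_cap (gen_ideal s) (gen_ideal t)) m)
         (symbolic_pow (ideal_cap (gen_ideal s) (gen_ideal t)) m).
Proof.
move=> rs rt s0 t0 st hX; set I := gen_ideal s; set J := gen_ideal t.
have [hI hJ] : is_ideal I /\ is_ideal J by split; apply: gen_is_ideal.
have acyct : koszul_acyclic t I 1 by apply: koszul_acyclic_transverse hX.
have acycs : koszul_acyclic s J 1.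
  apply: (koszul_acyclic_transverse (N := N)) => //; first by rewrite addnC.
  by move=> i; have [a [b [Ia [Jb ->]]]] := hX i; exists b, a; rewrite addrC.
(* Positive length brings the top degree within the range of acyclicity, which starts at 1. *)
have colon u v y : (0 < size v)%N -> koszul_acyclic v (gen_ideal u) 1 ->
    (forall z, gen_ideal v z -> gen_ideal u (y * z)) -> gen_ideal u y.
  move=> v0 acyc yv; apply: koszul_top (gen_is_ideal u) _ _.
    by move=> i z vi; apply: acyc; apply: leq_trans vi.
  by move=> f /gen_mem; apply: yv.
move=> x; split=> [xm p [[_ [p1 _]] _]|xm]; first by exists 1; rewrite mul1r.
have Ix : ideal_pow I m x.
  by apply: symbolic_pow_sub xm => // y; apply: colon.
have Jx : ideal_pow J m x.
  apply: (@symbolic_pow_sub t I) => [//|//|y|]; first exact: colon.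
  suff -> : ideal_cap J I = ideal_cap I J by [].
  by apply: pset_ext => y; split; case.
(* [pow_cap_mul] is used twice: from I and J to I^m and J, then from these to I^m and J^m. *)
apply: mul_pow_cap => //; apply: pow_cap_mul => //; first exact: pow_is_ideal.
move=> y Jy Iy; apply: ideal_mulC.
by apply: pow_cap_mul => // z Iz Jz; apply: koszul_cap_mul.
Qed.

Lemma regular_seq_rev s : regular_seq s -> rev_regular (rev s).
Proof.
case=> + _; elim/last_ind: s => // s f IHs reg; rewrite rev_rcons /=; split.
  apply: IHs => i si x; have := reg i; rewrite size_rcons ltnS ltnW // => /(_ isT x).
  by rewrite nth_rcons si -cats1 takel_cat ?(ltnW si).
have s_rev x : gen_ideal s x -> gen_ideal (rev s) x.
  by apply: gen_sub => y; rewrite mem_rev.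
have rev_s x : gen_ideal (rev s) x -> gen_ideal s x.
  by apply: gen_sub => y; rewrite mem_rev.
move=> x /rev_s fx; apply: s_rev; have := reg (size s).
rewrite size_rcons ltnSn nth_rcons ltnn eqxx -cats1 take_size_cat // => /(_ isT).
by apply; rewrite mulrC.
Qed.

Lemma complete_intersection_rev r I : complete_intersection_ideal r I ->
  exists s, [/\ rev_regular s, size s = (n - 1 - r)%N & I = gen_ideal s].
Proof.
case=> s [sz [_ [reg IE]]]; exists (rev s); rewrite size_rev; split=> //.
  exact: regular_seq_rev.
apply: pset_ext => x; rewrite IE.
by split; apply: gen_sub => y; rewrite mem_rev.
Qed.

End SymbolicPowers.

Theorem theorem3p3 (k : closedFieldType) (hchar : [pchar k] =i pred0)
  (r : nat) (I1 I2 : @pset (2 * r + 2)%N k) :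
  complete_intersection_ideal r I1 ->
  complete_intersection_ideal r I2 ->
  disjoint_schemes I1 I2 ->
  forall m : nat, (0 < m)%N ->
    set_eq (ideal_pow (ideal_cap I1 I2) m) (symbolic_pow (ideal_cap I1 I2) m).
Proof.
move=> /complete_intersection_rev[s [rs ss ->]].
move=> /complete_intersection_rev[t [rt tt ->]] [N hX] m _.
(* The two lengths add up to the number of variables, as transversality requires. *)
have codim : (2 * r + 2 - 1 - r)%N = r.+1.
  by rewrite mul2n -addnn addn2 subn1 /= -addnS addKn.
rewrite codim in ss tt.
apply: (symbolic_pow_transverse (N := N)) => //; rewrite ?ss ?tt //.
by rewrite mul2n -addnn addnS addSn addn2.
Qed.
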